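(* In the CFL problem described in the context, there exists a family of CFL instances such that any deterministic online algorithm for CFL is at least $\alpha$-competitive, where $$\alpha := \left[ W\!\left( \left( \frac{2\beta}{U} + \frac{L}{U} - 1 \right) e^{\frac{2\beta}{U}-1} \right) - \frac{2\beta}{U} + 1 \right]^{-1}$$ and $W$ is the Lambert $W$ function.
   Context: CFL setting. Fix $d\ge1$, a constraint weight vector $\mathbf{c}\in\mathbb{R}^d_{>0}$, a switching weight vector $\mathbf{w}\in\mathbb{R}^d_{\ge0}$ and constants $0<L<U$. For a weight vector $\mathbf{v}$ write $\|\mathbf{x}\|_{\ell_1(\mathbf{v})}=\sum_i \mathbf{v}^i|\mathbf{x}^i|$. The constraint function is $c(\mathbf{x})=\|\mathbf{x}\|_{\ell_1(\mathbf{c})}$ and the decision set is $X=\{\mathbf{x}\in[0,1]^d : c(\mathbf{x})\le 1\}$. Let $\beta:=\max_i \mathbf{w}^i/\mathbf{c}^i$, assumed to satisfy $0\le\beta<(U-L)/2$. An instance consists of a horizon $T$ and convex cost functions $f_1,\dots,f_T:X\to\mathbb{R}$ with $f_t(\mathbf{0})=0$ and $L\le [\nabla f_t]^i/\mathbf{c}^i\le U$ for all $i,t$. Online, at each time $t$ the function $f_t$ is revealed and then the player irrevocably chooses $\mathbf{x}_t\in X$. With $\mathbf{x}_0=\mathbf{x}_{T+1}=\mathbf{0}$, the cost is $\sum_{t=1}^T f_t(\mathbf{x}_t)+\sum_{t=1}^{T+1}\|\mathbf{x}_t-\mathbf{x}_{t-1}\|_{\ell_1(\mathbf{w})}$, subject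 to $\sum_{t=1}^T c(\mathbf{x}_t)\ge 1$. Utilization $z^{(t)}=\sum_{\tau\le t}c(\mathbf{x}_\tau)$; as soon as $(T-(j+1))\mathbf{c}^i<1-z^{(j)}$ for all $i$ at some time $j$, a compulsory trade makes maximal decisions to complete the constraint. $\mathtt{OPT}(\mathcal{I})$ is the offline optimum; an online algorithm is $\eta$-competitive if its cost is at most $\eta\,\mathtt{OPT}(\mathcal{I})$ on every instance $\mathcal{I}$. *)

(* Defs.v *)
From HB Require Import structures.
From mathcomp Require Import all_boot all_order all_algebra.
From mathcomp Require Import all_classical all_reals all_analysis.

Set Implicit Arguments.
Unset Strict Implicit.
Unset Printing Implicit Defensive.

Import Order.TTheory GRing.Theory Num.Theory.
Import numFieldNormedType.Exports.

Local Open Scope classical_set_scope.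
Local Open Scope ring_scope.

(* Principal branch: for y >= - expR (-1) there is exactly one w >= -1 with
   w * expR w = y. Below - expR (-1) the value is the junk value 0. *)
Definition lambertW (R : realType) (y : R) : R :=
  xget 0 [set w : R | w * expR w = y /\ -1 <= w].

Section CFL.
Context {R : realType} {d : nat}.
Implicit Types (c w v x y g : 'rV[R]_d) (L U : R).

Definition wl1norm v x : R := \sum_(i < d) v 0 i * `|x 0 i|.

Definition decision_set c : set 'rV[R]_d :=
  [set x : 'rV[R]_d | (forall i, 0 <= x 0 i <= 1) /\ wl1norm c x <= 1].

(* The ratios are nonnegative, so for d > 0 the default value 0 is harmless. *)
Definition beta c w : R := \big[Num.max/0]_(i < d) (w 0 i / c 0 i).

(* Functions X -> R are represented by total functions; only the values on X
   are constrained below or enter the costs. *)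
Definition cost_fun := 'rV[R]_d -> R.

(* g is the gradient at x of f restricted to X; X being closed, differentiability
   at its boundary points is relative to X. *)
Definition gradient_within (X : set 'rV[R]_d) (f : cost_fun) x g : Prop :=
  forall e : R, 0 < e ->
    \forall y \near within X (nbhs x),
      `|f y - f x - \sum_(i < d) g 0 i * (y 0 i - x 0 i)| <= e * `|y - x|.

Definition admissible_cost c L U (f : cost_fun) : Prop :=
  [/\ convex_function (decision_set c) f,
      f 0 = 0 &
      forall x, decision_set c x ->
        exists2 g, gradient_within (decision_set c) f x g &
          forall i, L <= g 0 i / c 0 i <= U].

(* An instance is the sequence f_1, ..., f_T, so T = size I.
   Decisions are indexed from 1 to T; other indices of xs are ignored. *)
Implicit Types (I : seq cost_fun) (xs : nat -> 'rV[R]_d).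

Definition cost_at I (t : nat) : cost_fun := nth (fun=> 0) I t.-1.

Definition utilization c xs (t : nat) : R :=
  \sum_(1 <= s < t.+1) wl1norm c (xs s).

Definition feasible c I xs : Prop :=
  (forall t, (1 <= t <= size I)%N -> decision_set c (xs t)) /\
  1 <= utilization c xs (size I).

(* Imposes x_0 = x_{T+1} = 0. *)
Definition with_endpoints (T : nat) xs (t : nat) : 'rV[R]_d :=
  if (1 <= t <= T)%N then xs t else 0.

Definition total_cost w I xs : R :=
  \sum_(1 <= t < (size I).+1) cost_at I t (xs t) +
  \sum_(1 <= t < (size I).+2)
    wl1norm w (with_endpoints (size I) xs t - with_endpoints (size I) xs t.-1).

(* Instances whose horizon is too short to admit any feasible solution have no
   offline optimum and are excluded. *)
Definition cfl_instance c L U I : Prop :=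
  (forall t, (1 <= t <= size I)%N -> admissible_cost c L U (cost_at I t)) /\
  exists xs, feasible c I xs.

Definition OPT c w I : R := inf [set total_cost w I xs | xs in feasible c I].

(* A deterministic online algorithm maps the horizon T and f_1, ..., f_t to x_t. *)
Definition online_algorithm := nat -> seq cost_fun -> 'rV[R]_d.

Definition play (alg : online_algorithm) I (t : nat) : 'rV[R]_d :=
  alg (size I) (take t I).

Definition compulsory_at c (T : nat) xs (j : nat) : Prop :=
  forall i : 'I_d, (T%:R - j.+1%:R) * c 0 i < 1 - utilization c xs j.

(* Once triggered at time j, the compulsory trade governs all later decisions:
   each one completes the constraint or has the largest possible c-value. *)
Definition compulsory_trade c (T : nat) xs : Prop :=
  forall j k, (j <= k < T)%N -> compulsory_at c T xs j ->
    1 <= utilization c xs k.+1 \/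
    (forall y, decision_set c y -> wl1norm c y <= wl1norm c (xs k.+1)).

Definition cfl_algorithm c L U (alg : online_algorithm) : Prop :=
  forall I, cfl_instance c L U I ->
    feasible c I (play alg I) /\ compulsory_trade c (size I) (play alg I).

Definition competitive_on c w (F : set (seq cost_fun)) (alg : online_algorithm)
    (eta : R) : Prop :=
  forall I, F I -> total_cost w I (play alg I) <= eta * OPT c w I.

Definition alpha c w L U : R :=
  let b := beta c w in
  (lambertW ((2 * b / U + L / U - 1) * expR (2 * b / U - 1))
   - 2 * b / U + 1)^-1.

End CFL.

(* Main.v *)
Require Import Defs.
From HB Require Import structures.
From mathcomp Require Import all_boot all_order all_algebra.
From mathcomp Require Import all_classical all_reals all_analysis.
From mathcomp Require Import ring lra.

Import Order.TTheory GRing.Theory Num.Theory.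
Import numFieldNormedType.Exports.

Local Open Scope classical_set_scope.
Local Open Scope ring_scope.

(* Let k maximise w^i / c^i and b = w^k / c^k. All costs are linear, with unit
   price U except for the price p announced in coordinate k. The adversary
   lowers p along a grid from U / alpha to L. At each price it makes up to M
   consecutive offers, but as soon as the player accepts a non-negligible amount
   it answers with a long block of price U: the player must then leave its
   position, so that every accepted unit costs p + 2 b. Once M offers in a row
   are rejected, the offline player could have spread its demand over them at
   cost p + 2 b / M, and the price is lowered. Stopping at price p_i and finishing
   at price U, eta-competitiveness demands
   U - \sum_(j <= i) (U - 2 b - p_j) Y_j <= eta * p_i up to small errors, where
   Y_j is the amount accepted at price p_j. Summation by parts turns these
   constraints into a lower bound on \sum_j Y_j, which exceeds 1 when
   eta < alpha: in the limit the bound is eta * \int_L^(U/alpha) dp / (U - 2 b - p)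
   plus a positive boundary term, and the equation defining alpha says that the
   integral equals 1 / alpha. *)

(** * The equation satisfied by the Lambert value behind [alpha] *)

Section LambertW.
Context {R : realType}.
Implicit Types x y v : R.

(** The tangent bound [1 + (v - x) <= expR (v - x)], multiplied by the nonpositive [v], reduces this
    to [(v - x) * (1 + v) <= 0]. *)
Lemma mulr_expR_homo v x : -1 <= v -> v <= x -> x <= 0 ->
  v * expR v <= x * expR x.
Proof.
move=> v1 vx x0.
have -> : expR v = expR (v - x) * expR x by rewrite -expRD subrK.
rewrite mulrA ler_wpM2r ?expR_ge0//.
have := expR_ge1Dx (v - x); set e := expR _ => he.
have : v * e <= v * (1 + (v - x)) by rewrite ler_wnM2l//; lra.
nra.
Qed.

Lemma lambertWP x y : -1 <= x -> x <= 0 -> x * expR x <= y -> y <= 0 ->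
  lambertW y * expR (lambertW y) = y /\ -1 <= lambertW y.
Proof.
move=> x1 x0 xy y0; rewrite /lambertW.
apply: (@xgetPex _ 0 [set w : R | w * expR w = y /\ -1 <= w]).
have [//|||v] := @IVT R (fun w => w * expR w) x 0 y.
- apply: continuous_subspaceT => z.
  by apply: cvgM; [exact: cvg_id|exact: continuous_expR].
- by rewrite mul0r ge_min xy le_max y0 orbT.
- rewrite in_itv/= => /andP[xv _] vy; exists v; split=> //.
  exact: le_trans xv.
Qed.

(** Applied with [a = L / U] and [b = 2 * beta / U]; then [s] is the inverse of [alpha], and the
    last equation is the integral identity for [alpha] in exponentiated form. *)
Lemma lambertW_shift (a b : R) : 0 < a -> 0 <= b -> a + b < 1 ->
  let s := lambertW ((b + a - 1) * expR (b - 1)) - b + 1 in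
  [/\ 0 < s, s < 1 - b & (1 - b - s) * expR s = 1 - b - a].
Proof.
move=> a0 b0 ab.
set y := (_ * _); set w := lambertW y => /=.
have by_ : (b - 1) * expR (b - 1) < y by rewrite ltr_pM2r ?expR_gt0//; lra.
have y0 : y < 0 by rewrite /y nmulr_rlt0 ?expR_gt0//; lra.
have [] := @lambertWP (b - 1) y _ _ (ltW by_) (ltW y0); rewrite -/w; try lra.
move=> wy w1.
have w0 : w < 0.
  rewrite ltNge; apply/negP => w0.
  by move: y0; rewrite -wy ltNge mulr_ge0 ?expR_ge0.
split.
- suff : b - 1 < w by lra.
  rewrite ltNge; apply/negP => wb.
  by have := mulr_expR_homo _ _ w1 wb; rewrite wy => H; have := H ltac:(lra); lra.
- lra.
- have : - w * expR w = - (b + a - 1) * expR (b - 1) by rewrite !mulNr wy.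
  have -> : expR (w - b + 1) = expR w / expR (b - 1).
    by rewrite -expRN -expRD; congr expR; ring.
  move=> H; rewrite mulrA (_ : 1 - b - (w - b + 1) = - w); last ring.
  by rewrite H mulfK ?gt_eqF ?expR_gt0//; ring.
Qed.

End LambertW.

(** * The price game, abstracted from vectors and algorithms *)

Section PriceGame.
(** A history is the list of prices offered so far: [u] is the amount bought at its last step, [a]
    the part of it bought at the offered price, [Z] and [C] the accumulated amount and cost. *)
Context {R : realType} (L U b : R) (a u C Z : seq R -> R).
Context (b_ge0 : 0 <= b) (L_ge0 : 0 <= L) (leLU : L <= U).
Context (a_ge0 : forall s, 0 <= a s) (a_le_u : forall s, a s <= u s).
Context (a_nil : a [::] = 0) (C_nil : C [::] = 0) (Z_nil : Z [::] = 0).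
Context (Z_rcons : forall s p, Z (rcons s p) = Z s + u (rcons s p)).
Context (C_rcons : forall s p,
  C s + (p * a (rcons s p) + U * (u (rcons s p) - a (rcons s p)))
      + b * `|a (rcons s p) - a s| <= C (rcons s p)).

Local Ltac market_facts :=
  have b_nneg := b_ge0; have L_nneg := L_ge0; have LU_le := leLU.

(** [l] values the open position: [l = b] refunds the cost of entering it, [l = - b] charges the
    cost of leaving it as well. *)
Definition potential (l : R) s := C s - l * a s.

Definition priced := all (fun p : R => L <= p <= U).

Lemma priced_nseq n p : L <= p <= U -> priced (nseq n p).
Proof. by move=> Hp; rewrite /priced all_nseq Hp orbT. Qed.

Lemma cat_nseqS (s : seq R) n p : s ++ nseq n.+1 p = rcons (s ++ nseq n p) p.
Proof. by rewrite -addn1 nseqD catA cats1. Qed.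

Lemma potential_rcons l l' s p : - b <= l <= b ->
  potential l s + (p * a (rcons s p) + U * (u (rcons s p) - a (rcons s p)))
    + (l - l') * a (rcons s p) <= potential l' (rcons s p).
Proof.
move=> /andP[l1 l2]; have := C_rcons s p; rewrite /potential.
set x := a (rcons s p); set y := a s.
suff : l * (x - y) <= b * `|x - y| by move=> H1 H2; lra.
have [h|h] := ger0P (x - y).
  by rewrite ler_wpM2r.
nra.
Qed.

Let b_range : - b <= b <= b.
Proof. by market_facts; apply/andP; split; lra. Qed.

Lemma potential_price s p : 0 <= p <= U ->
  potential b s + p * u (rcons s p) <= potential b (rcons s p).
Proof.
market_facts.
move=> /andP[p0 pU].
have := potential_rcons b b s p b_range.
have := a_le_u (rcons s p); have := a_ge0 (rcons s p); nra.
Qed.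

(** Moving the multiplier from [b] to [- b] charges each accepted unit a full round trip; units
    bought elsewhere cost [U], which is no less. *)
Lemma potential_accept s p : p + 2 * b <= U ->
  potential b s + (p + 2 * b) * u (rcons s p) <= potential (- b) (rcons s p).
Proof.
market_facts.
move=> pU; have := potential_rcons b (- b) s p b_range.
have := a_le_u (rcons s p); have := a_ge0 (rcons s p); nra.
Qed.

Lemma potential_tail s n :
  potential b s + U * (Z (s ++ nseq n U) - Z s) <= potential b (s ++ nseq n U).
Proof.
market_facts.
elim: n => [|n IH]; first by rewrite cats0; lra.
rewrite cat_nseqS Z_rcons.
have := @potential_price (s ++ nseq n U) U ltac:(lra); lra.
Qed.

Lemma Z_cat s t : Z s <= Z (s ++ t).
Proof.
market_facts.
elim/last_ind: t => [|t p IH]; first by rewrite cats0.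
rewrite -rcons_cat Z_rcons.
have := a_le_u (rcons (s ++ t) p); have := a_ge0 (rcons (s ++ t) p); lra.
Qed.

Lemma potential_cat s t : priced t -> potential b s <= potential b (s ++ t).
Proof.
market_facts.
elim/last_ind: t => [|t p IH]; first by rewrite cats0.
rewrite /priced all_rcons -rcons_cat => /andP[/andP[p1 p2] /IH H].
have := @potential_price (s ++ t) p ltac:(lra).
have := a_le_u (rcons (s ++ t) p); have := a_ge0 (rcons (s ++ t) p); nra.
Qed.

Lemma potential_ge0 s : priced s -> 0 <= potential b s.
Proof.
market_facts.
move=> /(@potential_cat [::]); rewrite cat0s; apply: le_trans.
by rewrite /potential a_nil C_nil; lra.
Qed.

(* Raising the multiplier from - b to b in m equal steps makes every unit
   bought during the block cost at least U - 2 b / m, so that keeping a position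
   alive is no way around the switching cost. *)
Lemma potential_block s m : (0 < m)%N ->
  potential (- b) s + (U - 2 * b / m%:R) * (Z (s ++ nseq m U) - Z s)
    <= potential b (s ++ nseq m U).
Proof.
market_facts.
move=> m0; have m0' : 0 < m%:R :> R by rewrite ltr0n.
have H n : (n <= m)%N ->
    potential (- b) s + (U - 2 * b / m%:R) * (Z (s ++ nseq n U) - Z s)
    <= potential (- b + 2 * b / m%:R * n%:R) (s ++ nseq n U).
  elim: n => [|n IH] nm; first by rewrite cats0 mulr0 addr0 subrr mulr0 addr0.
  have {}IH := IH (ltnW nm).
  rewrite cat_nseqS Z_rcons.
  have d0 : 0 <= 2 * b / m%:R by rewrite divr_ge0// mulr_ge0.
  have dn : 2 * b / m%:R * n%:R <= 2 * b.
    by rewrite -mulrA ler_piMr ?mulr_ge0// ler_pdivrMl// mulr1 ler_nat ltnW.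
  have dn0 : 0 <= 2 * b / m%:R * n%:R by rewrite mulr_ge0.
  move: IH dn dn0; move: d0; set e := 2 * b / m%:R; set en := e * n%:R.
  move=> e0 IH dn dn0.
  have -> : e * n.+1%:R = en + e by rewrite -natr1 /en; ring.
  have := @potential_rcons (- b + en) (- b + (en + e)) (s ++ nseq n U) U
            ltac:(lra).
  set s1 := rcons _ _.
  have : 0 <= e * (u s1 - a s1) by rewrite mulr_ge0// subr_ge0.
  lra.
have := H m (leqnn m); rewrite divfK ?gt_eqF//.
by congr (_ <= potential _ _); ring.
Qed.

(** [M] is the number of offers per run, [m] the length of the answering block of price [U], and
    [delta] a common bound for the errors per unit. *)
Context (eps theta delta : R) (M m : nat).
Context (eps_gt0 : 0 < eps) (theta_gt0 : 0 < theta).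
Context (thetaU : theta * U <= delta) (m_gt0 : (0 < m)%N).
Context (block_delta : 2 * b / m%:R <= delta) (delta_le : delta <= L).

Let delta_ge0 : 0 <= delta.
Proof. exact: le_trans (mulr_ge0 (ltW theta_gt0) (le_trans L_ge0 leLU)) thetaU. Qed.

Local Ltac error_facts :=
  market_facts; have d_nneg := delta_ge0; have theta_pos := theta_gt0; have dL := delta_le;
  have tU := thetaU; have bd := block_delta; have e_pos := eps_gt0.

Let K := 1 + theta^-1.

Let K_ge1 j : 1 <= K ^+ j.
Proof. by rewrite exprn_ege1// /K lerDl invr_ge0 ltW. Qed.

Let thetaK : theta * K = theta + 1.
Proof. by rewrite /K mulrDr mulr1 mulfV ?gt_eqF. Qed.

(* The j-th offer of a run counts as accepted when it is filled by at least
   eps * K ^+ j. The geometric growth of the thresholds keeps the amount bought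
   before the acceptance below a fraction theta of the accepted amount. *)
Lemma run_outcome s p j : L <= p -> p + 2 * b <= U ->
  (exists t Y V,
     [/\ priced t, (size t <= j + m)%N, eps <= Y, 0 <= V &
         Z (s ++ t) = Z s + Y + V /\
         potential b s + (p + 2 * b - delta) * Y + (U - delta) * V
           <= potential b (s ++ t)]) \/
  Z (s ++ nseq j p) <= Z s + theta * eps * K ^+ j.
Proof.
error_facts.
move=> Lp pU; elim: j => [|j [[t [Y [V [t1 t2 t3 t4 t5]]]]|IH]].
- by right; rewrite cats0 expr0 mulr1 lerDl mulr_ge0// ltW.
- by left; exists t, Y, V; split=> //; rewrite (leq_trans t2)// leq_add2r.
have pLU : L <= p <= U by lra.
set s1 := s ++ nseq j p in IH *; set s2 := rcons s1 p.
have Zs1 : Z s <= Z s1 := Z_cat s _.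
have ps1 : potential b s <= potential b s1 by apply/potential_cat/priced_nseq.
have [lt|ge] := ltrP (u s2) (eps * K ^+ j).
  right; rewrite cat_nseqS -/s1 Z_rcons -/s2 exprS.
  (* Since [theta * K = theta + 1], the old bound plus one more threshold is exactly the new
     bound. *)
  have -> : theta * eps * (K * K ^+ j) = theta * K * (eps * K ^+ j) by ring.
  rewrite thetaK; lra.
(* [Y] also counts the small amounts bought earlier in this run; the amount bought during the block
   of price [U] goes to [V]. *)
left; exists (nseq j.+1 p ++ nseq m U), (Z s1 - Z s + u s2),
  (Z (s2 ++ nseq m U) - Z s2).
rewrite catA cat_nseqS -/s1 -/s2; split.
- by rewrite /priced all_cat -!/(priced _) !priced_nseq//; lra.
- by rewrite size_cat !size_nseq.
- have : eps * 1 <= eps * K ^+ j by rewrite ler_pM2l.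
  lra.
- by rewrite subr_ge0 Z_cat.
- split; first by rewrite Z_rcons -/s2; ring.
  have B := potential_block s2 m m_gt0.
  have A := @potential_accept s1 p pU; rewrite -/s2 in A.
  have VV := Z_cat s2 (nseq m U).
  have H1 : (U - delta) * (Z (s2 ++ nseq m U) - Z s2) <=
     (U - 2 * b / m%:R) * (Z (s2 ++ nseq m U) - Z s2).
    by rewrite ler_wpM2r ?subr_ge0// lerD2l lerN2.
  have u0 : 0 <= u s2.
    by rewrite (le_trans _ ge)// mulr_ge0 ?ltW// (lt_le_trans ltr01).
  have r1 : Z s1 - Z s <= theta * u s2.
    have : theta * (eps * K ^+ j) <= theta * u s2 by rewrite ler_pM2l.
    rewrite mulrA; lra.
  set r := Z s1 - Z s in r1 *; set x := u s2 in u0 r1 A *.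
  (* The earlier amount [r] is at most [theta * x], and its cost is not counted; the discount
     [delta] on the unit price makes up for it. *)
  have H2 : (p + 2 * b - delta) * (r + x) <= (p + 2 * b) * x.
    have : (p + 2 * b - delta) * (r + x) <= (p + 2 * b - delta) * (theta * x + x).
      by rewrite ler_wpM2l ?lerD2r//; lra.
    have : theta * (p + 2 * b - delta) <= delta.
      by rewrite (le_trans _ thetaU)// ler_pM2l//; lra.
    move=> /(ler_wpM2r u0); lra.
  lra.
Qed.

(** Runs are repeated until one is rejected or [n] have been accepted. The rejected run stays at the
    end of the history, where it offers the offline player [M] equal prices in a row. *)
Lemma stage_outcome s p n : L <= p -> p + 2 * b <= U ->
  (exists t Y V,
     [/\ priced t, (size t <= n * (M + m))%N, n%:R * eps <= Y, 0 <= V &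
         Z (s ++ t) = Z s + Y + V /\
         potential b s + (p + 2 * b - delta) * Y + (U - delta) * V
           <= potential b (s ++ t)]) \/
  (exists t Y V r,
     [/\ priced t, (size t <= n * (M + m))%N, 0 <= Y, 0 <= V &
      [/\ 0 <= r <= theta * eps * K ^+ M,
          Z (s ++ t ++ nseq M p) = Z s + Y + V + r &
          potential b s + (p + 2 * b - delta) * Y + (U - delta) * V
            <= potential b (s ++ t ++ nseq M p)]]).
Proof.
error_facts.
move=> Lp pU; have pLU : L <= p <= U by lra.
elim: n => [|n [[t [Y [V [t1 t2 t3 t4 [t5 t6]]]]]|
                [t [Y [V [r [t1 t2 t3 t4 t5]]]]]]].
- by left; exists [::], 0, 0; split=> //; rewrite ?mul0r// cats0; split; lra.
- have [[t' [Y' [V' [r1 r2 r3 r4 [r5 r6]]]]]|rej] := @run_outcome (s ++ t) p M Lp pU.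
    left; exists (t ++ t'), (Y + Y'), (V + V'); rewrite catA; split.
    + by rewrite /priced all_cat -!/(priced _) t1.
    + by rewrite size_cat mulSn addnC leq_add.
    + by rewrite -natr1 mulrDl mul1r lerD.
    + exact: addr_ge0.
    + split; [rewrite r5 t5; ring|lra].
  right; exists t, Y, V, (Z (s ++ t ++ nseq M p) - Z (s ++ t)).
  split=> //; first by rewrite (leq_trans t2)// leq_mul.
    by rewrite (le_trans _ t3)// mulr_ge0// ltW.
  have := Z_cat (s ++ t) (nseq M p).
  rewrite catA => Zst; split; [lra|rewrite t5; ring|].
  exact/(le_trans t6)/potential_cat/priced_nseq.
- right; exists t, Y, V, r; split=> //; rewrite (leq_trans t2)// leq_mul//.
Qed.

Context (eta : R) (T Q : nat).
Context (competitive : forall s p, priced s -> L <= p <= U ->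
  (size s + M <= T)%N ->
  let full := s ++ nseq M p ++ nseq (T - (size s + M)) U in
  C full <= eta * (p + 2 * b / M%:R) /\ 1 <= Z full).
Context (Q_large : eta * (U + 2 * b / M%:R) < Q%:R * eps * (L - delta)).

(* The bookkeeping of the player on the history s: S is the part of the unit
   demand bought in accepted offers, V the amount bought at price U, r the
   amount bought in rejected offers, and G = \sum_j (U - 2 b - p_j) Y_j where
   Y_j is the share of S bought at price p_j. Since S is capped at 1, buying
   more than the demand does not help. *)
Definition ledger s (S G V r : R) :=
  [/\ 0 <= V /\ 0 <= r, 0 <= S <= 1, Num.min 1 (Z s) <= S + V + r &
      U * S - G - delta * S + (U - delta) * V <= potential b s].

(** [Q] accepted runs cannot occur: their cost of at least [(L - delta) * (Q * eps)] would exceed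
    what [competitive] allows if price [U] followed. So the stage ends with a rejected run. *)
Lemma ledger_stage s p S G V r : ledger s S G V r -> priced s ->
  L <= p -> p + 2 * b <= U -> (size s + Q * (M + m) + M <= T)%N ->
  exists t y V' r',
    [/\ priced t, (size t <= Q * (M + m))%N, 0 <= y,
        r' <= r + theta * eps * K ^+ M &
        ledger (s ++ t ++ nseq M p) (S + y) (G + (U - 2 * b - p) * y) V' r'].
Proof.
error_facts.
move=> [[V0 r0] /andP[S0 S1] Zs Ps] ps Lp pU sT.
have [[t [Y [W [t1 t2 t3 t4 [t5 t6]]]]]|] := @stage_outcome s p Q Lp pU.
  exfalso.
  have pst : priced (s ++ t) by rewrite /priced all_cat -!/(priced _) ps.
  have UU : L <= U <= U by lra.
  have szT : (size (s ++ t) + M <= T)%N.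
    by rewrite size_cat (leq_trans _ sT)// leq_add2r leq_add2l.
  have [] := @competitive (s ++ t) U pst UU szT.
  set tl := nseq M U ++ _ => H _.
  have ptl : priced tl.
    by rewrite /priced all_cat -!/(priced _) !priced_nseq.
  have := potential_cat (s ++ t) _ ptl; rewrite {2}/potential.
  have : 0 <= b * a ((s ++ t) ++ tl) by rewrite mulr_ge0.
  have := potential_ge0 _ ps.
  have : (L - delta) * (Q%:R * eps) <= (p + 2 * b - delta) * Y.
    by apply: ler_pM=> //; [lra|rewrite mulr_ge0// ltW|lra].
  have : 0 <= (U - delta) * W by rewrite mulr_ge0//; lra.
  have := Q_large; lra.
move=> [t [Y [W [r' [t1 t2 t3 t4 [t5 t6 t7]]]]]].
exists t, (Num.min Y (1 - S)), (V + W), (r + r').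
have y1 : Num.min Y (1 - S) <= Y by rewrite ge_min lexx.
have y2 : Num.min Y (1 - S) <= 1 - S by rewrite ge_min lexx orbT.
have y0 : 0 <= Num.min Y (1 - S) by rewrite le_min t3 subr_ge0.
have y3 : Num.min Y (1 - S) = Y \/ Num.min Y (1 - S) = 1 - S.
  by case: (leP Y (1 - S)); [left|right].
move: (Num.min Y (1 - S)) y0 y1 y2 y3 => y y0 y1 y2 y3.
move: Zs; rewrite !ge_min => Zs.
split=> //; first lra; split; [lra|lra| |].
- rewrite t6 ge_min; case: y3 => ->; last by apply/orP; left; lra.
  by case/orP: Zs => Zs; apply/orP; [left|right]; lra.
- have : (p + 2 * b - delta) * y <= (p + 2 * b - delta) * Y.
    by rewrite ler_wpM2l//; lra.
  lra.
Qed.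

(** Suppose price [U] fills the rest of the horizon: the missing demand then costs [U] per unit,
    while the offline player can use the rejected run at price [p]. *)
Lemma ledger_cost s p S G V r : ledger (s ++ nseq M p) S G V r -> priced s ->
  L <= p <= U -> (size s + M <= T)%N ->
  U - delta - U * r - eta * (p + 2 * b / M%:R) <= G.
Proof.
error_facts.
move=> [[V0 r0] /andP[S0 S1] Zs Ps] ps pLU sT.
have [] := @competitive s p ps pLU sT.
rewrite catA; set s1 := s ++ nseq M p in Zs Ps *; set n := (T - _)%N => H1 H2.
have H3 := @potential_tail s1 n.
have H4 := Z_cat s1 (nseq n U).
have H5 : potential b (s1 ++ nseq n U) <= C (s1 ++ nseq n U).
  by rewrite /potential gerBl mulr_ge0.
have : 1 - S - r <= V + (Z (s1 ++ nseq n U) - Z s1).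
  by move: Zs; rewrite ge_min => /orP[]; lra.
move: H3 H4; set W := _ - Z s1 => H3 H4 H6.
have W0 : 0 <= W by rewrite /W subr_ge0.
have : (U - delta) * (1 - S - r) <= (U - delta) * (V + W).
  by rewrite ler_wpM2l//; lra.
have : 0 <= delta * W by rewrite mulr_ge0.
have : 0 <= delta * r by rewrite mulr_ge0.
lra.
Qed.

Context (N : nat) (g0 rho E : R) (g0_gt0 : 0 < g0) (rho_ge1 : 1 <= rho).
Context (g0_le : g0 <= U - 2 * b) (gN : g0 * rho ^+ N = U - 2 * b - L).
Context (T_large : (N.+1 * (Q * (M + m) + M) <= T)%N).
Context (E_large : delta + U * (N.+1%:R * (theta * eps * K ^+ M))
                   + eta * (2 * b / M%:R) <= E).

Local Ltac grid_facts :=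
  error_facts; have g0_pos := g0_gt0; have g0_bnd := g0_le; have gNE := gN;
  have EE := E_large.

(** The gap [U - 2 * b - p] grows geometrically, which makes all terms of the Riemann sum of
    [dp / (U - 2 * b - p)] equal to [1 - rho^-1]. *)
Let g j := g0 * rho ^+ j.
Let price j := U - 2 * b - g j.

Let g_gt0 j : 0 < g j.
Proof. by rewrite mulr_gt0// exprn_gt0// (lt_le_trans ltr01). Qed.

Let g_homo i j : (i <= j)%N -> g i <= g j.
Proof. by move=> ij; rewrite ler_pM2l// ler_weXn2l. Qed.

Let price_ge j : (j <= N)%N -> L <= price j.
Proof. by grid_facts; move/g_homo; rewrite {2}/g gN /price; lra. Qed.

(* The last inequality is a summation by parts: it bounds S = \sum_j Y_j from
   below in terms of the constraints U - E - eta * price j <= G_j. *)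
Lemma ledger_invariant i : (i <= N)%N ->
  exists s S G V r,
  [/\ priced s, (size s + M <= i.+1 * (Q * (M + m) + M))%N,
      r <= i.+1%:R * (theta * eps * K ^+ M),
      ledger (s ++ nseq M (price i)) S G V r &
      U - E - eta * price i <= G /\
      (U - E - eta * price 0) / g 0 + i%:R * eta * (1 - rho^-1)
      + (G - (U - E - eta * price i)) / g i <= S].
Proof.
grid_facts.
(* [E] absorbs the unit errors, the rejected amounts of at most [N.+1] stages and the offline
   switching cost. *)
have cost j s S G V r : (j <= N)%N -> priced s ->
    (size s + M <= j.+1 * (Q * (M + m) + M))%N ->
    r <= j.+1%:R * (theta * eps * K ^+ M) ->
    ledger (s ++ nseq M (price j)) S G V r -> U - E - eta * price j <= G.
  move=> jN ps sz rr led.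
  have pj : L <= price j <= U.
    by rewrite price_ge//= /price; have := g_gt0 j; lra.
  have sT : (size s + M <= T)%N.
    by rewrite (leq_trans sz)// (leq_trans _ T_large)// leq_mul2r ltnS jN orbT.
  have := @ledger_cost s (price j) S G V r led ps pj sT.
  have : U * r <= U * (N.+1%:R * (theta * eps * K ^+ M)).
    apply: ler_wpM2l; first lra.
    apply: (le_trans rr); apply: ler_wpM2r; last by rewrite ler_nat ltnS.
    by rewrite mulr_ge0 ?mulr_ge0 ?ltW// (lt_le_trans ltr01).
  rewrite mulrDr; lra.
elim: i => [_|i IH iN].
  have led0 : ledger [::] 0 0 0 0.
    split; [lra|lra|by rewrite Z_nil ge_min; apply/orP; right; lra|].
    by rewrite /potential a_nil C_nil; lra.
  have [||t [y [V [r [t1 t2 y0 rr led]]]]] :=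
    @ledger_stage [::] (price 0) 0 0 0 0 led0 isT (price_ge 0 (leq0n _)).
  - by rewrite /price; have := g_gt0 0; lra.
  - by rewrite add0n (leq_trans _ T_large)// leq_pmull.
  move: led; rewrite cat0s !add0r => led.
  have sz : (size t + M <= 1 * (Q * (M + m) + M))%N by rewrite mul1n leq_add2r.
  have rr' : r <= 1%:R * (theta * eps * K ^+ M) by lra.
  exists t, y, ((U - 2 * b - price 0) * y), V, r; split=> //.
  split; first exact: cost led.
  rewrite !mul0r addr0 -mulrDl ler_pdivrMr//.
  by rewrite (_ : U - 2 * b - price 0 = g 0) 1?mulrC; [lra|rewrite /price; ring].
have [s [S [G [V [r [s1 s2 s3 s4 [s5 s6]]]]]]] := IH (ltnW iN).
have pri : L <= price i <= U.
  by rewrite price_ge 1?ltnW//= /price; have := g_gt0 i; lra.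
have ps : priced (s ++ nseq M (price i)).
  by rewrite /priced all_cat -!/(priced _) s1 priced_nseq.
have [||t [y [V' [r' [t1 t2 y0 rr led]]]]] :=
    @ledger_stage _ (price i.+1) _ _ _ _ s4 ps (price_ge _ iN).
- by rewrite /price; have := g_gt0 i.+1; lra.
- have : (i.+2 * (Q * (M + m) + M) <= T)%N.
    by apply: leq_trans T_large; rewrite leq_mul2r ltnS iN orbT.
  apply: leq_trans.
  by rewrite size_cat size_nseq -addnA [leqLHS]addnC mulSn leq_add2l.
exists ((s ++ nseq M (price i)) ++ t), (S + y),
  (G + (U - 2 * b - price i.+1) * y), V', r'.
rewrite catA in led.
have sz : (size ((s ++ nseq M (price i)) ++ t) + M <= i.+2 * (Q * (M + m) + M))%N.
  by rewrite !size_cat size_nseq -addnA [leqLHS]addnC mulSn leq_add ?leq_add2r.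
have rr' : r' <= i.+2%:R * (theta * eps * K ^+ M).
  by rewrite -natr1 mulrDl mul1r; lra.
have pst : priced ((s ++ nseq M (price i)) ++ t).
  by rewrite /priced all_cat -!/(priced _) ps.
split=> //.
have cst := @cost i.+1 _ _ _ _ _ iN pst sz rr' led.
split; first exact: cst.
have gE : U - 2 * b - price i.+1 = g i.+1 by rewrite /price; ring.
rewrite gE -natr1.
have rho0 : 0 < rho by apply: lt_le_trans rho_ge1.
(* The surplus over the constraint is nonnegative, so dividing it by the larger gap can only lose;
   this is the summation by parts. *)
have H : (G - (U - E - eta * price i)) / g i.+1 <= (G - (U - E - eta * price i)) / g i.
  by rewrite ler_wpM2l ?subr_ge0// lef_pV2 ?posrE// g_homo.
have -> : G + g i.+1 * y - (U - E - eta * price i.+1)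
   = (G - (U - E - eta * price i)) + g i.+1 * y - eta * (1 - rho^-1) * g i.+1.
  rewrite /price /g exprS; field; lra.
rewrite [X in _ + X <= _]mulrBl mulfK ?gt_eqF// [X in _ + (X - _) <= _]mulrDl.
rewrite [g i.+1 * y]mulrC mulfK ?gt_eqF//; lra.
Qed.

Lemma price_game_bound :
  (U - E - eta * (U - 2 * b - g0)) / g0 + N%:R * eta * (1 - rho^-1) <= 1.
Proof.
grid_facts.
have [s [S [G [V [r [_ _ _ [_ /andP[_ S1] _ _] [GN]]]]]]] :=
  ledger_invariant N (leqnn N).
rewrite /price /g expr0 mulr1 -/(g N).
have : 0 <= (G - (U - E - eta * price N)) / g N.
  by rewrite divr_ge0 ?subr_ge0// ltW.
rewrite /price; lra.
Qed.

End PriceGame.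

(** * Sums supported on a block or at a single index *)

Lemma sum_nat_block (V : nmodType) (v : V) (T n M : nat) : (n + M <= T)%N ->
  \sum_(1 <= t < T.+1) (if (n < t <= n + M)%N then v else 0) = v *+ M.
Proof.
move=> nMT.
rewrite (@big_cat_nat _ _ _ n.+1)//=; last by rewrite ltnS (leq_trans _ nMT)// leq_addr.
rewrite [X in X + _]big_nat_cond big1 ?add0r; last first.
  by move=> t /andP[/andP[_ tn] _]; rewrite ltnNge -ltnS tn.
rewrite (@big_cat_nat _ _ _ (n + M).+1)//= ?ltnS ?leq_addr//.
rewrite [X in _ + X]big_nat_cond [X in _ + X]big1 ?addr0; last first.
  by move=> t /andP[/andP[tn _] _]; rewrite [(t <= _)%N]leqNgt tn andbF.
rewrite big_nat_cond (eq_bigr (fun=> v)); last first.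
  by move=> t /andP[/andP[t1 t2] _]; rewrite t1 -ltnS t2.
by rewrite -big_nat_cond sumr_const_nat subSS addKn.
Qed.

Lemma sum_nat_pred1_le (R : numDomainType) (v : R) (m n j : nat) : 0 <= v ->
  \sum_(m <= t < n) (if t == j then v else 0) <= v.
Proof.
move=> v0; rewrite -big_mkcond/=.
have [jmn|jmn] := boolP (j \in index_iota m n).
  rewrite (big_rem j)//= eqxx big_seq_cond big1 ?addr0// => t /andP[].
  by rewrite mem_rem_uniq ?iota_uniq// inE => /andP[/negPf->].
rewrite big_seq_cond big_pred0// => t; apply/negP => /andP[tmn /eqP tj].
by rewrite -tj tmn in jmn.
Qed.

(** * Linear costs with a single variable price *)

Section Offers.
Context {R : realType} {d : nat} (c w : 'rV[R]_d) (L U : R) (k : 'I_d).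
Context (c_gt0 : forall i, 0 < c 0 i) (w_ge0 : forall i, 0 <= w 0 i).
Context (L_ge0 : 0 <= L) (leLU : L <= U).

Let b := w 0 k / c 0 k.

Definition offer (p : R) : @cost_fun R d :=
  fun x => \sum_(i < d) (if i == k then p else U) * c 0 i * x 0 i.

Lemma wl1norm_ge0 (v x : 'rV[R]_d) : (forall i, 0 <= v 0 i) -> 0 <= wl1norm v x.
Proof. by move=> v0; apply: sumr_ge0 => i _; rewrite mulr_ge0. Qed.

Lemma wl1norm0 (v : 'rV[R]_d) : wl1norm v 0 = 0.
Proof. by apply: big1 => i _; rewrite mxE normr0 mulr0. Qed.

Lemma wl1normN (v x : 'rV[R]_d) : wl1norm v (- x) = wl1norm v x.
Proof. by apply: eq_bigr => i _; rewrite mxE normrN. Qed.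

Lemma offer0 p : offer p 0 = 0.
Proof. by apply: big1 => i _; rewrite mxE mulr0. Qed.

Lemma decision_set0 : decision_set c (0 : 'rV[R]_d).
Proof. by split=> [i|]; rewrite ?mxE ?wl1norm0 ?lexx ler01. Qed.

Lemma offer_admissible p : L <= p <= U -> admissible_cost c L U (offer p).
Proof.
move=> pLU; split.
- move=> t x y _ _; rewrite convRE le_eqVlt; apply/orP; left; apply/eqP.
  rewrite /offer !mulr_sumr -[RHS]big_split; apply: eq_bigr => i _ /=.
  by rewrite !mxE; ring.
- exact: offer0.
- move=> x _; exists (\row_i ((if i == k then p else U) * c 0 i)); last first.
    move=> i; have ci : c 0 i != 0 by rewrite gt_eqF.
    by rewrite mxE mulfK//; case: (i == k); rewrite // leLU lexx.
  move=> e e0; apply: nearW => y; rewrite /offer -!sumrB big1 ?normr0.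
    by rewrite mulr_ge0// ltW.
  by move=> i _; rewrite mxE mulrBr subrr.
Qed.

Lemma offerE p x : decision_set c x ->
  offer p x = p * (c 0 k * x 0 k) + U * (wl1norm c x - c 0 k * x 0 k).
Proof.
move=> [x01 _]; rewrite /offer /wl1norm (bigD1 k)//= eqxx -mulrA; congr (_ + _).
have x0 i : `|x 0 i| = x 0 i by rewrite ger0_norm//; case/andP: (x01 i).
rewrite [\sum_(i < d) c 0 i * _](bigD1 k)//= x0 addrAC subrr add0r mulr_sumr.
by apply: eq_bigr => i /negPf ->; rewrite x0 mulrA.
Qed.

Lemma offer_ge0 p x : 0 <= p -> decision_set c x -> 0 <= offer p x.
Proof.
move=> p0 [x01 _]; apply: sumr_ge0 => i _.
have /andP[xi _] := x01 i.
have ci := ltW (c_gt0 i); rewrite !mulr_ge0//; case: (i == k) => //.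
exact: le_trans L_ge0 leLU.
Qed.

Lemma coord_le_wl1norm (v x : 'rV[R]_d) : (forall i, 0 <= v 0 i) ->
  v 0 k * `|x 0 k| <= wl1norm v x.
Proof.
move=> v0; rewrite /wl1norm (bigD1 k)//= lerDl.
by apply: sumr_ge0 => i _; rewrite mulr_ge0.
Qed.

Lemma switching_cost_ge (x y : 'rV[R]_d) :
  b * `|c 0 k * x 0 k - c 0 k * y 0 k| <= wl1norm w (x - y).
Proof.
apply: le_trans (coord_le_wl1norm w (x - y) w_ge0).
rewrite -mulrBr normrM gtr0_norm// mulrA divfK ?gt_eqF//.
by rewrite !mxE.
Qed.

Definition offers (s : seq R) : seq (@cost_fun R d) := [seq offer p | p <- s].

Lemma size_offers s : size (offers s) = size s.
Proof. exact: size_map. Qed.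

Lemma cost_at_offers s t : (t < size s)%N ->
  cost_at (offers s) t.+1 = offer (nth 0 s t).
Proof. by move=> ts; rewrite /cost_at/= (nth_map 0). Qed.

Lemma total_cost_ge0 s xs : priced L U s -> feasible c (offers s) xs ->
  0 <= total_cost w (offers s) xs.
Proof.
move=> ps [Hx _]; apply: addr_ge0; last first.
  by apply: sumr_ge0 => t _; exact: wl1norm_ge0.
rewrite big_add1 big_nat; apply: sumr_ge0 => t /andP[_].
rewrite size_offers/= => ts; rewrite cost_at_offers//; apply: offer_ge0.
  by have /andP[/(le_trans L_ge0)] := all_nthP 0 ps t ts.
by apply: Hx; rewrite size_offers.
Qed.

(** * The offline plan that spreads the demand over [M] equal offers *)

Section Block.
Context (M : nat) (M_large : 1 <= M%:R * c 0 k).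

Let M_gt0 : 0 < M%:R :> R.
Proof.
rewrite ltNge; apply/negP => M0; have := M_large.
by rewrite leNgt (le_lt_trans _ ltr01)// pmulr_lle0.
Qed.

Definition block_share : 'rV[R]_d :=
  \row_i (if i == k then (M%:R * c 0 k)^-1 else 0).

Lemma wl1norm_block_share (v : 'rV[R]_d) :
  wl1norm v block_share = v 0 k / c 0 k / M%:R.
Proof.
rewrite /wl1norm (bigD1 k)//= big1 ?addr0 => [|i /negPf ik].
  rewrite mxE eqxx ger0_norm ?invr_ge0 ?mulr_ge0 ?ltW//.
  by rewrite invfM; ring.
by rewrite mxE ik normr0 mulr0.
Qed.

Lemma wl1norm_c_block_share : wl1norm c block_share = M%:R^-1.
Proof. by rewrite wl1norm_block_share divff ?mul1r ?gt_eqF. Qed.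

Lemma decision_set_block_share : decision_set c block_share.
Proof.
split=> [i|]; last first.
  rewrite wl1norm_c_block_share invf_le1// ler1n -(ltr0n R)//.
rewrite mxE; case: ifP => _; last by rewrite lexx ler01.
have Mc : 0 < M%:R * c 0 k by rewrite mulr_gt0.
by rewrite invr_ge0 (ltW Mc) invf_le1//= M_large.
Qed.

Lemma offer_block_share p : offer p block_share = p / M%:R.
Proof.
rewrite offerE ?wl1norm_c_block_share; last exact: decision_set_block_share.
rewrite mxE eqxx invfM [c 0 k * _]mulrCA mulfV ?gt_eqF// mulr1 subrr mulr0.
by rewrite addr0.
Qed.

Definition block_plan (n : nat) (t : nat) : 'rV[R]_d :=
  if (n < t <= n + M)%N then block_share else 0.

Lemma block_plan_feasible s n : (n + M <= size s)%N ->
  feasible c (offers s) (block_plan n).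
Proof.
move=> ns; split=> [t _|].
  rewrite /block_plan; case: ifP => _; first exact: decision_set_block_share.
  exact: decision_set0.
rewrite /utilization size_offers.
rewrite (eq_bigr (fun t => if (n < t <= n + M)%N then M%:R^-1 else 0)).
  by rewrite sum_nat_block// -(mulr_natr M%:R^-1) mulVf ?gt_eqF.
move=> t _; rewrite /block_plan; case: ifP => _; last exact: wl1norm0.
exact: wl1norm_c_block_share.
Qed.

Lemma block_plan_cost s s1 p s2 : s = s1 ++ nseq M p ++ s2 ->
  total_cost w (offers s) (block_plan (size s1)) <= p + 2 * b / M%:R.
Proof.
move=> sE; set n := size s1.
have ns : (n + M <= size s)%N.
  by rewrite sE !size_cat size_nseq addnA leq_addr.
rewrite /total_cost size_offers; apply: lerD.
  rewrite (@eq_big_nat _ _ _ _ _ _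
    (fun t => if (n < t <= n + M)%N then p / M%:R else 0)).
    by rewrite sum_nat_block// -(mulr_natr (p / M%:R)) divfK ?gt_eqF.
  move=> [//|t] /andP[_ ts]; rewrite cost_at_offers// /block_plan.
  case: ifP => [/andP[nt tn]|_]; last exact: offer0.
  rewrite offer_block_share sE nth_cat -/n ltnNge -ltnS nt/=.
  by rewrite nth_cat size_nseq ltn_subLR ?tn ?nth_nseq// ltn_subLR ?tn.
pose W := wl1norm w block_share.
have W0 : 0 <= W by apply: wl1norm_ge0.
(* Switching occurs only on entering the block at [n.+1] and on leaving it at [(n + M).+1], which
   may be the final return to 0. *)
apply: (@le_trans _ _ (\sum_(1 <= t < (size s).+2)
   ((if t == n.+1 then W else 0) + (if t == (n + M).+1 then W else 0)))).
  rewrite big_nat [leRHS]big_nat; apply: ler_sum => -[//|t] /andP[_ ts].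
  have inb j : (n < j <= n + M)%N -> (0 < j <= size s)%N.
    by move=> /andP[nj jn]; rewrite (leq_ltn_trans _ nj)// (leq_trans jn).
  have plan j : with_endpoints (size s) (block_plan n) j = block_plan n j.
    rewrite /with_endpoints; case: ifP => // jT; rewrite /block_plan.
    by case: ifP => // /inb; rewrite jT.
  rewrite !plan /block_plan /=.
  have M0 : (0 < M)%N by rewrite -(ltr0n R).
  rewrite ltnS !eqSS.
  case: (ltngtP n t) => nt; case: (ltngtP t (n + M)%N) => tM;
    rewrite ?(ltnW tM) ?subrr ?subr0 ?sub0r ?add0r ?addr0 ?wl1norm0
      ?wl1normN ?addr_ge0//=.
rewrite big_split/= -mulrA mulr_natl mulr2n.
by apply: lerD; rewrite (le_trans (sum_nat_pred1_le _ _ _ _ _ _))// /W wl1norm_block_share.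
Qed.

Lemma OPT_ge0 s : (M <= size s)%N -> priced L U s -> 0 <= OPT c w (offers s).
Proof.
move=> Ms ps; apply: lb_le_inf.
  exists (total_cost w (offers s) (block_plan 0)), (block_plan 0) => //.
  exact: block_plan_feasible.
by move=> _ [xs fxs <-]; exact: total_cost_ge0.
Qed.

Lemma OPT_block s s1 p s2 : s = s1 ++ nseq M p ++ s2 ->
  priced L U s -> OPT c w (offers s) <= p + 2 * b / M%:R.
Proof.
move=> sE ps; apply: le_trans (block_plan_cost _ _ _ _ sE); apply: ge_inf.
  by exists 0 => _ [xs fxs <-]; exact: total_cost_ge0.
exists (block_plan (size s1)) => //; apply: block_plan_feasible.
by rewrite sE !size_cat size_nseq addnA leq_addr.
Qed.

Lemma cfl_instance_offers s : (M <= size s)%N -> priced L U s ->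
  cfl_instance c L U (offers s).
Proof.
move=> Ms ps; split; last first.
  by exists (block_plan 0); exact: block_plan_feasible.
move=> [//|t]; rewrite size_offers /= => ts; rewrite cost_at_offers//.
exact/offer_admissible/(all_nthP 0 ps).
Qed.

(** * The online algorithm as a player of the price game *)

Section Play.
Context (alg : @online_algorithm R d) (T : nat) (MT : (M <= T)%N).
Context (alg_cfl : cfl_algorithm c L U alg).

(* Histories that are too long or contain an illegal price are answered by 0,
   so that the estimates below hold for all histories. *)
Definition answer (s : seq R) : 'rV[R]_d :=
  if [&& s != [::], priced L U s & (size s <= T)%N] then alg T (offers s) else 0.

Lemma answer_decision s : decision_set c (answer s).
Proof.
rewrite /answer; case: ifP => [/and3P[s0 ps sT]|_]; last exact: decision_set0.
(* The answer depends only on the horizon and the prefix, so padding the history with price [U] to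
   length [T] leaves it unchanged. *)
set s' := s ++ nseq (T - size s) U.
have s'T : size s' = T by rewrite size_cat size_nseq subnKC.
have [|[+ _] _] := alg_cfl (offers s').
  apply: cfl_instance_offers; first by rewrite s'T.
  by rewrite /priced all_cat -!/(priced _ _ _) ps priced_nseq// leLU lexx.
move=> /(_ (size s)); rewrite size_offers s'T sT andbT lt0n size_eq0 s0.
by move=> /(_ isT); rewrite /play size_offers s'T -map_take take_size_cat.
Qed.

Definition answer_share s := c 0 k * answer s 0 k.
Definition answer_use s := wl1norm c (answer s).
Definition history_use s := \sum_(0 <= t < size s) answer_use (take t.+1 s).
(** The final return to 0 is left out, so this only bounds the total cost from below. *)
Definition history_cost s :=
  \sum_(0 <= t < size s) (offer (nth 0 s t) (answer (take t.+1 s)) +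
    wl1norm w (answer (take t.+1 s) - answer (take t s))).

Lemma answer_share_ge0 s : 0 <= answer_share s.
Proof.
have [x01 _] := answer_decision s.
by apply: mulr_ge0; [exact: ltW|case/andP: (x01 k)].
Qed.

Lemma answer_share_le s : answer_share s <= answer_use s.
Proof.
apply: le_trans (coord_le_wl1norm c (answer s) _); last by move=> i; exact: ltW.
by rewrite ler_pM2l// ler_norm.
Qed.

Lemma answer_nil : answer [::] = 0. Proof. by []. Qed.

Lemma take_rcons_le (s : seq R) p t : (t <= size s)%N -> take t (rcons s p) = take t s.
Proof. by move=> ts; rewrite -cats1 takel_cat. Qed.

Lemma history_use_rcons s p :
  history_use (rcons s p) = history_use s + answer_use (rcons s p).
Proof.
rewrite /history_use size_rcons big_nat_recr//= -(size_rcons s p) take_size.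
by congr (_ + _); apply: eq_big_nat => t /andP[_ ts]; rewrite take_rcons_le.
Qed.

Lemma history_cost_rcons s p :
  history_cost s + (p * answer_share (rcons s p)
    + U * (answer_use (rcons s p) - answer_share (rcons s p)))
    + b * `|answer_share (rcons s p) - answer_share s| <= history_cost (rcons s p).
Proof.
rewrite /history_cost size_rcons big_nat_recr//= -(size_rcons s p) take_size.
rewrite nth_rcons ltnn eqxx take_rcons_le// take_size.
rewrite -offerE; last exact: answer_decision.
rewrite -addrA lerD//; last by rewrite lerD// switching_cost_ge.
rewrite le_eqVlt; apply/orP; left; apply/eqP; apply: eq_big_nat => t /andP[_ ts].
by rewrite nth_rcons ts !take_rcons_le// ltnW.
Qed.

Lemma play_answer s t : priced L U s -> size s = T -> (1 <= t <= T)%N ->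
  play alg (offers s) t = answer (take t s).
Proof.
move=> ps sT /andP[t0 tT].
rewrite /play size_offers sT -map_take /answer /offers size_take_min sT.
rewrite geq_minr (_ : priced L U (take t s)) ?andbT; last first.
  by move: ps; rewrite /priced -{1}(cat_take_drop t s) all_cat => /andP[].
rewrite -size_eq0 size_take_min sT (minn_idPl tT).
by case: t t0 {tT}.
Qed.

Lemma total_cost_play s : priced L U s -> size s = T ->
  history_cost s <= total_cost w (offers s) (play alg (offers s)).
Proof.
move=> ps sT; rewrite /total_cost size_offers sT.
have endpoint t : (t <= T)%N ->
    with_endpoints T (play alg (offers s)) t = answer (take t s).
  case: t => [|t] tT; first by rewrite take0.
  by rewrite /with_endpoints tT /= play_answer.
rewrite [X in X + _]big_add1 [X in _ + X]big_add1/= big_nat_recr//= addrA.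
apply: ler_wpDr; first exact: wl1norm_ge0.
rewrite /history_cost sT -big_split/= le_eqVlt; apply/orP; left; apply/eqP.
apply: eq_big_nat => t /andP[_ tT].
by rewrite cost_at_offers ?sT// play_answer// !endpoint// ltnW.
Qed.

Lemma utilization_play s : priced L U s -> size s = T ->
  utilization c (play alg (offers s)) T = history_use s.
Proof.
move=> ps sT; rewrite /utilization big_add1 /= /history_use sT.
by apply: eq_big_nat => t tT; rewrite play_answer.
Qed.

Lemma history_competitive (eta : R) :
  (forall I, cfl_instance c L U I ->
     total_cost w I (play alg I) <= eta * OPT c w I) ->
  forall s p, priced L U s -> L <= p <= U -> (size s + M <= T)%N ->
  let full := s ++ nseq M p ++ nseq (T - (size s + M)) U in
  history_cost full <= Num.max eta 0 * (p + 2 * b / M%:R) /\ 1 <= history_use full.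
Proof.
move=> comp s p ps pLU sMT full.
have sz : size full = T by rewrite !size_cat !size_nseq addnA subnKC.
have pf : priced L U full.
  by rewrite /priced !all_cat -!/(priced _ _ _) ps !priced_nseq// leLU lexx.
have inst : cfl_instance c L U (offers full).
  by apply: cfl_instance_offers => //; rewrite sz.
split.
  apply: le_trans (total_cost_play _ pf sz) _; apply: le_trans (comp _ inst) _.
  (* [eta] might be negative a priori; the maximum with 0 permits bounding [OPT] from above by the
     cost of a block. *)
  apply: (@le_trans _ _ (Num.max eta 0 * OPT c w (offers full))).
    by rewrite ler_wpM2r ?le_max ?lexx// OPT_ge0// sz.
  by rewrite ler_wpM2l ?le_max ?lexx ?orbT//; exact: OPT_block pf.
have [[_]] := alg_cfl _ inst.
by rewrite size_offers sz utilization_play.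
Qed.

End Play.
End Block.
End Offers.

(** * Choice of the parameters and conclusion *)

Lemma ltr_truncnS_div {R : realType} (x y : R) : 0 < y ->
  x < (Num.truncn (x / y)).+1%:R * y.
Proof. by move=> y0; rewrite -ltr_pdivrMr// truncnS_gt. Qed.

(** [N * (1 - exp (- s / N))] tends to [s]; an explicit [N] above [s ^+ 2 / e] suffices because
    [exp (- x) <= 1 - x + x ^+ 2] for positive [x]. *)
Lemma geometric_grid {R : realType} (s e : R) : 0 < s -> 0 < e ->
  exists2 N : nat, (0 < N)%N & s - e <= N%:R * (1 - (expR (s / N%:R))^-1).
Proof.
move=> s0 e0; exists (Num.truncn (s ^+ 2 / e)).+1 => //.
have := ltr_truncnS_div (s ^+ 2) _ e0; set N := (Num.truncn _).+1 => HN.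
have N0 : 0 < N%:R :> R by rewrite ltr0n.
set x := s / N%:R.
have x0 : 0 < x by rewrite divr_gt0.
have xN : N%:R * x = s by rewrite mulrC divfK ?gt_eqF.
have H : (expR x)^-1 <= 1 - x + x ^+ 2.
  rewrite invf_ple ?posrE ?expR_gt0//; last by nra.
  apply: le_trans (expR_ge1Dx x); rewrite -[leLHS]mul1r ler_pdivrMr; last nra.
  have : 0 <= x ^+ 3 by rewrite exprn_ge0// ltW.
  lra.
have : N%:R * x ^+ 2 <= e.
  have -> : N%:R * x ^+ 2 = s ^+ 2 / N%:R.
    by rewrite /x; field; rewrite gt_eqF.
  by rewrite ler_pdivrMr// [e * _]mulrC ltW.
have : N%:R * (1 - (1 - x + x ^+ 2)) <= N%:R * (1 - (expR x)^-1).
  by rewrite ler_pM2l// lerD2l lerN2.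
lra.
Qed.

(** The first grid price is [U * s], and the last hypothesis says that a geometric grid of gaps with
    ratio [expR (s / N)] brings the price down to [L] after [N] steps. *)
Lemma competitive_ratio_le (R : realType) (d : nat) (c w : 'rV[R]_d) (L U : R)
    (k : 'I_d) (alg : @online_algorithm R d) (eta s : R) :
  (forall i, 0 < c 0 i) -> (forall i, 0 <= w 0 i) -> 0 < L -> L < U ->
  let b := w 0 k / c 0 k in
  cfl_algorithm c L U alg ->
  (forall I, cfl_instance c L U I ->
     total_cost w I (play alg I) <= eta * OPT c w I) ->
  0 < s -> 0 < U - 2 * b - U * s ->
  (U - 2 * b - U * s) * expR s = U - 2 * b - L ->
  1 <= Num.max eta 0 * s.
Proof.
move=> c0 w0 L0 LU b alg_cfl comp s0 g0_gt0 gE.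
have b0 : 0 <= b by rewrite divr_ge0// ltW.
have ck := c0 k.
rewrite leNgt; apply/negP; set e := Num.max eta 0 => es1.
have e0 : 0 <= e by rewrite le_max lexx orbT.
set g0 := U - 2 * b - U * s in g0_gt0 gE.
have U0 : 0 < U by lra.
(* Without errors and in the limit of fine grids, [price_game_bound] would read [1 + kap <= 1]. One
   third of [kap] is conceded to [E], another to the grid. *)
pose kap := (1 - e * s) * (U / g0 - 1).
have kap0 : 0 < kap.
  rewrite mulr_gt0 ?subr_gt0// ltr_pdivlMr// mul1r /g0.
  have : 0 < U * s by rewrite mulr_gt0.
  lra.
pose E := g0 * (kap / 3).
have E0 : 0 < E by rewrite mulr_gt0// divr_gt0.
have [N N0 HN] : exists2 N : nat, (0 < N)%N &
    e * s - kap / 3 <= N%:R * e * (1 - (expR (s / N%:R))^-1).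
  have e1 : 0 < e + 1 by lra.
  have [N N0 H] := @geometric_grid R s (kap / 3 / (e + 1)) s0
     ltac:(by rewrite !divr_gt0).
  exists N => //; rewrite [N%:R * e]mulrC -[leRHS]mulrA.
  apply: le_trans (ler_wpM2l e0 H); rewrite mulrBr lerD2l lerN2.
  rewrite mulrA ler_pdivrMr//; lra.
pose rho := expR (s / N%:R).
have rho1 : 1 <= rho by apply: le_trans (expR_ge1Dx _); rewrite lerDl divr_ge0// ltW.
have rhoN : g0 * rho ^+ N = U - 2 * b - L.
  by rewrite /rho -expRM_natl [N%:R * _]mulrC divfK ?gt_eqF ?ltr0n.
pose delta := Num.min (E / 3) (L / 2).
have d0 : 0 < delta by rewrite lt_min !divr_gt0.
have dE : delta <= E / 3 by rewrite ge_min lexx.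
have dL : delta <= L / 2 by rewrite ge_min lexx orbT.
pose theta := delta / U.
have theta0 : 0 < theta by rewrite divr_gt0.
pose m := (Num.truncn (2 * b / delta)).+1.
have hm : 2 * b / m%:R <= delta.
  by rewrite ler_pdivrMr ?ltr0n// [delta * _]mulrC ltW// ltr_truncnS_div.
pose M := (Num.truncn (1 / c 0 k) + Num.truncn (6 * e * b / E)).+1.
have M0 : 0 < M%:R :> R by rewrite ltr0n.
have hM1 : 1 <= M%:R * c 0 k.
  apply: ltW (lt_le_trans (ltr_truncnS_div 1 _ ck) _).
  by rewrite ler_pM2r// ler_nat ltnS leq_addr.
have hM2 : e * (2 * b / M%:R) <= E / 3.
  rewrite mulrA ler_pdivrMr//.
  have := ltr_truncnS_div (6 * e * b) _ E0.
  have : (Num.truncn (6 * e * b / E)).+1%:R * E <= M%:R * E.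
    by rewrite ler_pM2r// ler_nat ltnS leq_addl.
  lra.
pose K := 1 + theta^-1.
have K0 : 0 < K ^+ M by rewrite exprn_gt0// addr_gt0 ?invr_gt0.
(* The choices are made in the order [M], [eps], [Q], [T], each depending on the previous ones; this
   [eps] makes the allowance for rejected amounts exactly [E / 3]. *)
pose eps := E / 3 / (U * (N.+1%:R * (theta * K ^+ M))).
have den0 : 0 < U * (N.+1%:R * (theta * K ^+ M)).
  by rewrite mulr_gt0// mulr_gt0// mulr_gt0.
have eps0 : 0 < eps by rewrite divr_gt0// divr_gt0.
pose B := e * (U + 2 * b / M%:R).
have epsL : 0 < eps * (L - delta) by rewrite mulr_gt0//; lra.
pose Q := (Num.truncn (B / (eps * (L - delta)))).+1.
pose T := (N.+1 * (Q * (M + m) + M))%N.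
have MT : (M <= T)%N by rewrite /T mulSn -addnA addnCA leq_addr.
have leLU := ltW LU; have L_ge0 := ltW L0.
have bound : (U - E - e * (U - 2 * b - g0)) / g0 + N%:R * e * (1 - rho^-1) <= 1.
  apply: (@price_game_bound R L U b (answer_share c L U k alg T)
    (answer_use c L U k alg T) (history_cost c w L U k alg T)
    (history_use c L U k alg T) b0 L_ge0 leLU
    (answer_share_ge0 c L U k c0 leLU M hM1 alg T MT alg_cfl)
    (answer_share_le c L U k c0 alg T)
    _ _ _ (history_use_rcons c L U k alg T)
    (history_cost_rcons c w L U k c0 w0 leLU M hM1 alg T MT alg_cfl)
    eps theta delta M m eps0 theta0 _ _ hm _ e T Q
    (history_competitive c w L U k c0 w0 L_ge0 leLU M hM1 alg T MT alg_cfl eta comp)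
    _ N g0 rho E g0_gt0 rho1 _ rhoN (leqnn _)) => //.
  - by rewrite /answer_share answer_nil mxE mulr0.
  - by rewrite /history_cost big_nil.
  - by rewrite /history_use big_nil.
  - by rewrite divfK ?gt_eqF.
  - lra.
  - by rewrite -[ltRHS]mulrA; exact: ltr_truncnS_div.
  - have : 0 < U * s by rewrite mulr_gt0.
    by rewrite /g0; lra.
  - have -> : U * (N.+1%:R * (theta * eps * K ^+ M)) = E / 3.
      have -> : U * (N.+1%:R * (theta * eps * K ^+ M))
        = eps * (U * (N.+1%:R * (theta * K ^+ M))) by ring.
      by rewrite divfK ?gt_eqF.
    lra.
move: bound; apply/negP; rewrite -ltNge.
have -> : U - 2 * b - g0 = U * s by rewrite /g0; ring.
have -> : (U - E - e * (U * s)) / g0 = (1 - e * s) * (U / g0) - kap / 3.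
  by rewrite /E; field; rewrite gt_eqF.
rewrite -/rho in HN.
have : kap = (1 - e * s) * (U / g0) - (1 - e * s) by rewrite /kap; ring.
lra.
Qed.

Theorem theorem2 (R : realType) (d : nat) (c w : 'rV[R]_d) (L U : R)
    (d_ge1 : (1 <= d)%N)
    (c_gt0 : forall i, 0 < c 0 i)
    (w_ge0 : forall i, 0 <= w 0 i)
    (L_gt0 : 0 < L) (ltLU : L < U)
    (beta_bnd : 0 <= beta c w < (U - L) / 2) :
  exists F : set (seq (@cost_fun R d)),
    F `<=` cfl_instance c L U /\
    forall alg : @online_algorithm R d, cfl_algorithm c L U alg ->
      forall eta : R, competitive_on c w F alg eta -> alpha c w L U <= eta.
Proof.
(* The hard instance depends on the algorithm, so the family is taken to contain all instances. *)
exists (cfl_instance c L U); split=> // alg alg_cfl eta comp.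
have [k _ bk] := @eq_bigmax _ R 'I_d 0 (Ordinal d_ge1) xpredT
  (fun i => w 0 i / c 0 i) isT (fun i _ => divr_ge0 (w_ge0 i) (ltW (c_gt0 i))).
have bE : beta c w = w 0 k / c 0 k := bk.
rewrite /alpha bE; rewrite bE in beta_bnd; set b := w 0 k / c 0 k in beta_bnd *.
have /andP[b0 bUL] := beta_bnd.
have U0 : 0 < U by lra.
have a0 : 0 < L / U by rewrite divr_gt0.
have b0' : 0 <= 2 * b / U := divr_ge0 (mulr_ge0 (ler0n R 2) b0) (ltW U0).
have ab : L / U + 2 * b / U < 1 by rewrite -(mulrDl L) ltr_pdivrMr//; lra.
have [] := lambertW_shift _ _ a0 b0' ab.
set s := lambertW _ - _ + 1 => s0 sb sE.
have gE : U - 2 * b - U * s = U * (1 - 2 * b / U - s).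
  by field; rewrite gt_eqF.
have H : 1 <= Num.max eta 0 * s.
  apply: (competitive_ratio_le R d c w L U k alg eta s c_gt0 w_ge0 L_gt0 ltLU
    alg_cfl comp s0); rewrite -/b gE.
    by rewrite mulr_gt0//; lra.
  by rewrite -mulrA sE; field; rewrite gt_eqF.
have : 1 <= eta * s.
  by move: H; case: (leP eta 0) => // _; rewrite mul0r; lra.
by rewrite -ler_pdivrMr// mul1r.
Qed.
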